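(* For $m\in(0,1)$ and a convex polygon $K$ in the plane, let $K'$ denote the first $m$-Kasner descendant of $K$. (i) For any $m\in(0,1)$ and for any convex $n$-gon $K$ with $n\ge 6$, $$1-2m(1-m)<\frac{\Delta(K')}{\Delta(K)}<1.$$ (ii) For any $m\in(0,1)$, any integer $n\ge 6$ and any $\epsilon>0$ there exists a convex $n$-gon $K$ such that $$\frac{\Delta(K')}{\Delta(K)}<1-2m(1-m)+\epsilon.$$ (iii) For any $m\in(0,1)$, any integer $n\ge 6$ and any $\epsilon>0$ there exists a convex $n$-gon $K$ such that $$\frac{\Delta(K')}{\Delta(K)}>1-\epsilon.$$
   Context: $\Delta(\cdot)$ denotes the area of a polygon. Convex polygons are nondegenerate (any three consecutive vertices form a triangle of positive area). For $m\in(0,1)$ and a convex $n$-gon $K=A_1A_2\ldots A_n$ with vertices listed in counterclockwise cyclic order (indices modulo $n$), the first $m$-Kasner descendant of $K$ is the convex $n$-gon $K'=B_1B_2\ldots B_n$, where $B_i$ is the point on the side $A_iA_{i+1}$ with $A_iB_i:B_iA_{i+1}=m:(1-m)$, i.e. $\overrightarrow{A_iB_i}=m\,\overrightarrow{A_iA_{i+1}}$. *)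

(* Defs.v *)
From HB Require Import structures.
From mathcomp Require Import all_boot all_order all_algebra.
From mathcomp Require Import all_classical all_reals all_analysis.

Set Implicit Arguments.
Unset Strict Implicit.
Unset Printing Implicit Defensive.

Import Order.TTheory GRing.Theory Num.Theory.
Import numFieldNormedType.Exports.

Local Open Scope classical_set_scope.
Local Open Scope ring_scope.

(* A polygon is the family of its vertices, listed in cyclic order: the
   vertex following A i is A (ordS i), where ordS is the cyclic successor
   i |-> i.+1 %% n of 'I_n. *)

(* Positive iff a, b, c form a nondegenerate counterclockwise triangle, i.e.
   iff c lies strictly to the left of the oriented line ab. *)
Definition orient (R : realType) (a b c : R * R) : R :=
  (b.1 - a.1) * (c.2 - a.2) - (b.2 - a.2) * (c.1 - a.1).

(* Every vertex that is not an endpoint of a side lies strictly to the left of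
   the line carrying that side. This forces the vertices to be distinct, to be
   in strictly convex position (case j = ordS (ordS i): consecutive vertices
   are not collinear) and to be met in counterclockwise order exactly once;
   requiring positive consecutive triples alone would also admit star polygons
   such as the pentagram. *)
Definition convex_polygon (R : realType) (n : nat) (A : 'I_n -> R * R) : Prop :=
  (3 <= n)%N /\
  forall i j : 'I_n, j != i -> j != ordS i -> 0 < orient (A i) (A (ordS i)) (A j).

(* A convex polygon, as a region of the plane, is the convex hull of its
   vertices. *)
Definition polygon_region (R : realType) (n : nat) (A : 'I_n -> R * R) :
    set (R * R) :=
  [set p | exists w : 'I_n -> R,
     [/\ forall i, 0 <= w i, \sum_i w i = 1 & p = \sum_i w i *: A i]].

(* fine loses nothing: the region is bounded, so its measure is finite. *)
Definition area (R : realType) (n : nat) (A : 'I_n -> R * R) : R :=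
  fine ((lebesgue_measure \x lebesgue_measure)%E (polygon_region A)).

Definition kasner (R : realType) (m : R) (n : nat) (A : 'I_n -> R * R) :
    'I_n -> R * R :=
  fun i => A i + m *: (A (ordS i) - A i).

(* Main.v *)
(* Cutting the corners B_(i-1) A_i B_i off K shows that
   area K' = area K - m (1 - m) * (sum of the areas of the triangles
   A_(i-1) A_i A_(i+1)), so everything reduces to comparing this sum T with
   area K.  For a quadrilateral T is exactly twice the area, and adding a vertex
   to a convex polygon increases T by less than twice the increase of the area;
   this gives 0 < T < 2 area K.  For the converse, choose the vertices on a
   parabola: T is close to 2 area K when all vertices but two lie in a small
   cluster, one of these two being much farther away than the other, and T is
   close to 0 when the vertices lie in three small clusters. *)
Require Import Defs.
From HB Require Import structures.
From mathcomp Require Import all_boot all_order all_algebra.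
From mathcomp Require Import all_classical all_reals all_analysis.
From mathcomp Require Import zify ring lra.

Set Implicit Arguments.
Unset Strict Implicit.
Unset Printing Implicit Defensive.

Import Order.TTheory GRing.Theory Num.Theory.
Import numFieldNormedType.Exports.

Local Open Scope classical_set_scope.
Local Open Scope ring_scope.

(** * Planar measure of a triangle *)

Lemma measurable_halfplane (R : realType) (u v w : R) :
  measurable [set p : R * R | 0 <= u * p.1 + v * p.2 + w].
Proof.
have mf : measurable_fun setT (fun p : R * R => u * p.1 + v * p.2 + w).
  apply: measurable_realfun.measurable_funD => //.
  by apply: measurable_realfun.measurable_funD;
    apply: measurable_realfun.measurable_funM.
have := mf measurableT _ (measurable_itv `[0, +oo[).
rewrite setTI; congr measurable; apply/seteqP; split=> p /=;
  by rewrite in_itv /= andbT.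
Qed.

Lemma measurable_line (R : realType) (u v w : R) :
  measurable [set p : R * R | u * p.1 + v * p.2 + w = 0].
Proof.
rewrite (_ : mkset _ = [set p : R * R | 0 <= u * p.1 + v * p.2 + w] `&`
   [set p : R * R | 0 <= (- u) * p.1 + (- v) * p.2 + (- w)]).
  by apply: measurableI; exact: measurable_halfplane.
apply/seteqP; split=> p /=; last by case; lra.
by move=> h; split; lra.
Qed.

Local Notation mu2 := (lebesgue_measure \x lebesgue_measure)%E.

(** A vertical line is a point times the whole axis; on any other line each vertical section is a
    single point, so the integral of the section measures vanishes. *)
Lemma line_null (R : realType) (u v w : R) : (u != 0) || (v != 0) ->
  mu2 [set p : R * R | u * p.1 + v * p.2 + w = 0] = 0%E.
Proof.
have [-> /=|v0 _] := eqVneq v 0.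
  rewrite orbF => u0.
  rewrite (_ : mkset _ = [set - w / u] `*` setT).
    by rewrite product_measure1E//= lebesgue_measure_set1 mul0e.
  apply/seteqP; split=> -[x y] /=.
    by move=> h; split=> //; apply: (mulfI u0); rewrite [RHS]mulrC divfK//; lra.
  by case=> -> _; field.
apply: integral0_eq => x _ /=.
rewrite (_ : xsection _ x = [set - (u * x + w) / v]).
  exact: lebesgue_measure_set1.
apply/seteqP; split=> y /=; rewrite /xsection /= ?inE /=.
  by move=> h; apply: (mulfI v0); rewrite [RHS]mulrC divfK//; lra.
by move=> ->; field.
Qed.

(** The two closed half-planes overlap only in their null boundary line, so the second may be
    replaced by the complement of the first. *)
Lemma measure_line_split (R : realType) (u v w : R) (S : set (R * R)) :
  (u != 0) || (v != 0) -> measurable S ->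
  mu2 S = (mu2 (S `&` [set p | (0 <= u * p.1 + v * p.2 + w)%R]) +
           mu2 (S `&` [set p | (u * p.1 + v * p.2 + w <= 0)%R]))%E.
Proof.
move=> uv mS.
have mH := measurable_halfplane u v w.
have mL : measurable (S `&` [set p : R * R | u * p.1 + v * p.2 + w = 0]).
  by apply: measurableI => //; exact: measurable_line.
have mSH : measurable (S `&` [set p : R * R | 0 <= u * p.1 + v * p.2 + w]).
  exact: measurableI.
have mSD : measurable (S `\` [set p : R * R | 0 <= u * p.1 + v * p.2 + w]).
  exact: measurableD.
have -> : S `&` [set p | u * p.1 + v * p.2 + w <= 0] =
    (S `\` [set p | 0 <= u * p.1 + v * p.2 + w]) `|`
    (S `&` [set p | u * p.1 + v * p.2 + w = 0]).
  apply/seteqP; split=> p /=.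
    by case=> Sp h; case: (ltP (u * p.1 + v * p.2 + w) 0) => h';
      [left; split => //; apply/negP; rewrite -ltNge | right; split=> //; lra].
  by case=> -[Sp] h; split=> //; [move/negP: h; rewrite -ltNge; lra | lra].
rewrite measureU0//; last first.
  apply: subset_measure0 (line_null w uv) => //.
  exact: measurable_line.
rewrite -measureU//; last by rewrite setIACA setICr setI0.
by rewrite -setIUr setUCr setIT.
Qed.

Lemma integral_affine (R : realType) (a b u v : R) : a <= b ->
  (\int[lebesgue_measure]_(x in `[a, b]) (u * x + v)%:E)%E =
  (u * (b ^+ 2 - a ^+ 2) / 2 + v * (b - a))%:E.
Proof.
rewrite le_eqVlt => /predU1P[->|ab].
  by rewrite set_itv1 integral_set1; congr EFin; lra.
have cf : continuous (fun x : R => u * x + v).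
  move=> x; apply: cvgD; last exact: cvg_cst.
  by apply: cvgM; [exact: cvg_cst | exact: cvg_id].
have dF (x : R) : is_derive x 1 (fun y : R => u / 2 * y ^+ 2 + v * y) (u * x + v).
  by apply: is_derive_eq; rewrite /GRing.scale /=; lra.
have cF : continuous (fun y : R => u / 2 * y ^+ 2 + v * y : R).
  move=> x; apply: differentiable_continuous; apply/derivable1_diffP.
  by case: (dF x).
rewrite (@continuous_FTC2 _ _ (fun y : R => u / 2 * y ^+ 2 + v * y))//.
- by rewrite -EFinB; congr EFin; lra.
- exact: continuous_subspaceT.
- split.
  + by move=> x _; case: (dF x).
  + by apply: cvg_at_right_filter; exact: cF.
  + by apply: cvg_at_left_filter; exact: cF.
- by move=> x _; rewrite derive1E; case: (dF x).
Qed.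

(** The product measure integrates the lengths of the vertical sections. Comparing the two lines at
    [a] and [b] suffices because their difference is affine, so every section over this range is an
    interval of affine length. *)
Lemma measure_trapezoid (R : realType) (a b u v u' v' : R) : a <= b ->
  u * a + v <= u' * a + v' -> u * b + v <= u' * b + v' ->
  mu2 [set p : R * R | [/\ a <= p.1, p.1 <= b, u * p.1 + v <= p.2 &
                          p.2 <= u' * p.1 + v']] =
  ((u' - u) * (b ^+ 2 - a ^+ 2) / 2 + (v' - v) * (b - a))%:E.
Proof.
move=> ab ha hb.
rewrite -integral_affine// integral_mkcond.
apply: eq_integral => x _ /=; rewrite patchE.
case: ifPn => [|].
  rewrite inE /= in_itv /= => /andP[ax xb].
  rewrite (_ : xsection _ x = `[u * x + v, u' * x + v']%classic); last first.
    apply/seteqP; split=> y /=.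
      by move=> /xsectionP /= [_ _ ? ?]; rewrite in_itv /=; apply/andP.
    by rewrite in_itv /= => /andP[? ?]; apply/xsectionP.
  have h : u * x + v <= u' * x + v' by case: (leP u u') => ?; nra.
  rewrite lebesgue_measure_itv /= lte_fin.
  move: h; rewrite le_eqVlt => /predU1P[h|h].
    by rewrite h ltxx; congr EFin; lra.
  by rewrite h -EFinB; congr EFin; lra.
move=> /negP; rewrite inE /= in_itv /= => h.
rewrite (_ : xsection _ x = set0) ?measure0//.
by apply/seteqP; split=> y // /xsectionP /= [? ? _ _]; apply: h; apply/andP.
Qed.

Lemma orient_rot (R : realType) (a b c : R * R) : orient a b c = orient b c a.
Proof. by rewrite /orient; lra. Qed.

Lemma orient_affine (R : realType) (a b p : R * R) :
  orient a b p = (a.2 - b.2) * p.1 + (b.1 - a.1) * p.2 +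
                 ((b.2 - a.2) * a.1 - (b.1 - a.1) * a.2).
Proof. by rewrite /orient; lra. Qed.

(** Divided by [orient a b c], the three orientations of [p] are its barycentric coordinates. They
    sum to 1, so the origin [x] of abscissas is free; taking it at a vertex kills one term. *)
Lemma barycentric1 (R : realType) (a b c p : R * R) (x : R) :
  orient a b c * (p.1 - x) = orient b c p * (a.1 - x) +
    orient c a p * (b.1 - x) + orient a b p * (c.1 - x).
Proof. by rewrite /orient; ring. Qed.

(** Half-plane form, suited to measurability and to cutting; [triangle_region] relates it to convex
    hulls. *)
Definition triangle (R : realType) (a b c : R * R) : set (R * R) :=
  [set p | [/\ 0 <= orient a b p, 0 <= orient b c p & 0 <= orient c a p]].

Lemma triangle_rot (R : realType) (a b c : R * R) :
  triangle a b c = triangle b c a.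
Proof. by apply/seteqP; split=> p []. Qed.

Lemma measurable_orient_ge0 (R : realType) (a b : R * R) :
  measurable [set p | 0 <= orient a b p].
Proof.
under eq_set do rewrite orient_affine.
exact: measurable_halfplane.
Qed.

Lemma measurable_triangle (R : realType) (a b c : R * R) :
  measurable (triangle a b c).
Proof.
rewrite (_ : triangle a b c = [set p | 0 <= orient a b p] `&`
  ([set p | 0 <= orient b c p] `&` [set p | 0 <= orient c a p])).
  by do !apply: measurableI; exact: measurable_orient_ge0.
by apply/seteqP; split=> p /=; [case=> ? ? ?; do 2![split=> //] | case=> ? []].
Qed.

Definition slope (R : realType) (a b : R * R) := (b.2 - a.2) / (b.1 - a.1).

Definition intercept (R : realType) (a b : R * R) := a.2 - slope a b * a.1.

Lemma above_line (R : realType) (a b p : R * R) : a.1 < b.1 ->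
  (0 <= orient a b p) = (slope a b * p.1 + intercept a b <= p.2).
Proof.
move=> ab; have d0 : 0 < b.1 - a.1 by rewrite subr_gt0.
rewrite -[RHS]subr_ge0 -[RHS](pmulr_rge0 _ d0); congr (_ <= _).
by rewrite /intercept /slope /orient; field; rewrite gt_eqF.
Qed.

Lemma below_line (R : realType) (a b p : R * R) : a.1 < b.1 ->
  (0 <= orient b a p) = (p.2 <= slope a b * p.1 + intercept a b).
Proof.
move=> ab; have d0 : 0 < b.1 - a.1 by rewrite subr_gt0.
rewrite -[RHS]subr_ge0 -[RHS](pmulr_rge0 _ d0); congr (_ <= _).
by rewrite /intercept /slope /orient; field; rewrite gt_eqF.
Qed.

Lemma line_left (R : realType) (a b : R * R) :
  slope a b * a.1 + intercept a b = a.2.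
Proof. by rewrite /intercept; lra. Qed.

Lemma line_right (R : realType) (a b : R * R) : a.1 < b.1 ->
  slope a b * b.1 + intercept a b = b.2.
Proof.
by move=> ab; rewrite /intercept /slope; field; rewrite gt_eqF// subr_gt0.
Qed.

Lemma vertical_null (R : realType) (S : set (R * R)) (x : R) :
  measurable S -> (forall p, S p -> p.1 = x) -> mu2 S = 0%E.
Proof.
move=> mS Sx.
apply: subset_measure0 (@line_null _ 1 0 (- x) _) => //.
- exact: measurable_line.
- by move=> p /Sx /= ->; lra.
- by rewrite oner_neq0.
Qed.

Lemma measurable_le1 (R : realType) (x : R) :
  measurable [set p : R * R | p.1 <= x].
Proof.
rewrite (_ : mkset _ = [set p : R * R | 0 <= (-1) * p.1 + 0 * p.2 + x]).
  exact: measurable_halfplane.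
by apply/seteqP; split=> p /=; lra.
Qed.

Lemma measurable_ge1 (R : realType) (x : R) :
  measurable [set p : R * R | x <= p.1].
Proof.
rewrite (_ : mkset _ = [set p : R * R | 0 <= 1 * p.1 + 0 * p.2 + (- x)]).
  exact: measurable_halfplane.
by apply/seteqP; split=> p /=; lra.
Qed.

(** This and the next three lemmas cut a triangle with leftmost vertex [a] by the vertical through
    the vertex of middle abscissa, which lies below the opposite side ([b] under [a c]) or above it
    ([c] over [a b]). Each piece is a trapezoid between two side lines. *)
Lemma triangle_left_below (R : realType) (a b c : R * R) :
  0 < orient a b c -> a.1 <= b.1 -> b.1 <= c.1 -> a.1 < c.1 ->
  mu2 (triangle a b c `&` [set p | p.1 <= b.1]) =
  ((b.1 - a.1) * orient a b c / (2 * (c.1 - a.1)))%:E.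
Proof.
move=> D ab bc ac.
have ca : c.1 - a.1 != 0 by rewrite gt_eqF// subr_gt0.
(* If [a.1 = b.1], the piece lies on a vertical line, and [slope a b] would divide by zero. *)
move: (ab); rewrite le_eqVlt => /predU1P[abE|ltab].
  rewrite abE subrr !mul0r; apply: (@vertical_null _ _ b.1).
    by apply: measurableI; [exact: measurable_triangle|exact: measurable_le1].
  move=> p [[pab pbc pca] /= pb].
  apply/eqP; rewrite eq_le pb /= -subr_ge0 -(pmulr_rge0 _ D).
  by rewrite (barycentric1 _ _ _ _ b.1); nra.
rewrite (_ : _ `&` _ = [set p : R * R | [/\ a.1 <= p.1, p.1 <= b.1,
    slope a b * p.1 + intercept a b <= p.2 &
    p.2 <= slope a c * p.1 + intercept a c]]); last first.
  apply/seteqP; split=> p /=; rewrite -above_line// -below_line//.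
    move=> [[pab pbc pca] pb]; split=> //.
    by rewrite -subr_ge0 -(pmulr_rge0 _ D) (barycentric1 _ _ _ _ a.1); nra.
  move=> [pa pb pab pca]; split=> //; split=> //.
  (* To the left of [b] the side [b c] imposes nothing new: [barycentric1] at [b.1] makes
     [orient b c p * (b.1 - a.1)] a sum of nonnegative terms. *)
  have ba : 0 < b.1 - a.1 by rewrite subr_gt0.
  rewrite -(pmulr_lge0 _ ba).
  by have := barycentric1 a b c p b.1; nra.
rewrite measure_trapezoid//.
- congr EFin; rewrite /intercept /slope /orient; field.
  by rewrite ca gt_eqF// subr_gt0.
- by rewrite !line_left.
- by rewrite line_right// -below_line// orient_rot ltW.
Qed.

Lemma triangle_right_below (R : realType) (a b c : R * R) :
  0 < orient a b c -> a.1 <= b.1 -> b.1 <= c.1 -> a.1 < c.1 ->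
  mu2 (triangle a b c `&` [set p | b.1 <= p.1]) =
  ((c.1 - b.1) * orient a b c / (2 * (c.1 - a.1)))%:E.
Proof.
move=> D ab bc ac.
have ca : c.1 - a.1 != 0 by rewrite gt_eqF// subr_gt0.
move: (bc); rewrite le_eqVlt => /predU1P[bcE|ltbc].
  rewrite -bcE subrr !mul0r; apply: (@vertical_null _ _ b.1).
    by apply: measurableI; [exact: measurable_triangle|exact: measurable_ge1].
  move=> p [[pab pbc pca] /= pb].
  apply/eqP; rewrite eq_le pb andbT -subr_le0 -(pmulr_rle0 _ D).
  by rewrite (barycentric1 _ _ _ _ b.1); nra.
rewrite (_ : _ `&` _ = [set p : R * R | [/\ b.1 <= p.1, p.1 <= c.1,
    slope b c * p.1 + intercept b c <= p.2 &
    p.2 <= slope a c * p.1 + intercept a c]]); last first.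
  apply/seteqP; split=> p /=; rewrite -above_line// -below_line//.
    move=> [[pab pbc pca] pb]; split=> //.
    by rewrite -subr_le0 -(pmulr_rle0 _ D) (barycentric1 _ _ _ _ c.1); nra.
  move=> [pb pc pbc pca]; split=> //; split=> //.
  have cb : 0 < c.1 - b.1 by rewrite subr_gt0.
  rewrite -(pmulr_lge0 _ cb).
  by have := barycentric1 a b c p b.1; nra.
rewrite measure_trapezoid//.
- congr EFin; rewrite /intercept /slope /orient; field.
  by rewrite ca gt_eqF// subr_gt0.
- by rewrite line_left -below_line// orient_rot ltW.
- by rewrite !line_right.
Qed.

Lemma triangle_left_above (R : realType) (a b c : R * R) :
  0 < orient a b c -> a.1 <= c.1 -> c.1 <= b.1 -> a.1 < b.1 ->
  mu2 (triangle a b c `&` [set p | p.1 <= c.1]) =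
  ((c.1 - a.1) * orient a b c / (2 * (b.1 - a.1)))%:E.
Proof.
move=> D ac cb ab.
have ba : b.1 - a.1 != 0 by rewrite gt_eqF// subr_gt0.
move: (ac); rewrite le_eqVlt => /predU1P[acE|ltac].
  rewrite acE subrr !mul0r; apply: (@vertical_null _ _ c.1).
    by apply: measurableI; [exact: measurable_triangle|exact: measurable_le1].
  move=> p [[pab pbc pca] /= pc].
  apply/eqP; rewrite eq_le pc /= -subr_ge0 -(pmulr_rge0 _ D).
  by rewrite (barycentric1 _ _ _ _ c.1); nra.
rewrite (_ : _ `&` _ = [set p : R * R | [/\ a.1 <= p.1, p.1 <= c.1,
    slope a b * p.1 + intercept a b <= p.2 &
    p.2 <= slope a c * p.1 + intercept a c]]); last first.
  apply/seteqP; split=> p /=; rewrite -above_line// -below_line//.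
    move=> [[pab pbc pca] pc]; split=> //.
    by rewrite -subr_ge0 -(pmulr_rge0 _ D) (barycentric1 _ _ _ _ a.1); nra.
  move=> [pa pc pab pca]; split=> //; split=> //.
  have ca : 0 < c.1 - a.1 by rewrite subr_gt0.
  rewrite -(pmulr_lge0 _ ca).
  by have := barycentric1 a b c p c.1; nra.
rewrite measure_trapezoid//.
- congr EFin; rewrite /intercept /slope /orient; field.
  by rewrite ba gt_eqF// subr_gt0.
- by rewrite !line_left.
- by rewrite (line_right ltac) -above_line// ltW.
Qed.

Lemma triangle_right_above (R : realType) (a b c : R * R) :
  0 < orient a b c -> a.1 <= c.1 -> c.1 <= b.1 -> a.1 < b.1 ->
  mu2 (triangle a b c `&` [set p | c.1 <= p.1]) =
  ((b.1 - c.1) * orient a b c / (2 * (b.1 - a.1)))%:E.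
Proof.
move=> D ac cb ab.
have ba : b.1 - a.1 != 0 by rewrite gt_eqF// subr_gt0.
move: (cb); rewrite le_eqVlt => /predU1P[cbE|ltcb].
  rewrite -cbE subrr !mul0r; apply: (@vertical_null _ _ c.1).
    by apply: measurableI; [exact: measurable_triangle|exact: measurable_ge1].
  move=> p [[pab pbc pca] /= pc].
  apply/eqP; rewrite eq_le pc andbT -subr_le0 -(pmulr_rle0 _ D).
  by rewrite (barycentric1 _ _ _ _ c.1); nra.
rewrite (_ : _ `&` _ = [set p : R * R | [/\ c.1 <= p.1, p.1 <= b.1,
    slope a b * p.1 + intercept a b <= p.2 &
    p.2 <= slope c b * p.1 + intercept c b]]); last first.
  apply/seteqP; split=> p /=; rewrite -above_line// -below_line//.
    move=> [[pab pbc pca] pc]; split=> //.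
    by rewrite -subr_le0 -(pmulr_rle0 _ D) (barycentric1 _ _ _ _ b.1); nra.
  move=> [pc pb pab pbc]; split=> //; split=> //.
  have bc : 0 < b.1 - c.1 by rewrite subr_gt0.
  rewrite -(pmulr_lge0 _ bc).
  by have := barycentric1 a b c p c.1; nra.
rewrite measure_trapezoid//.
- congr EFin; rewrite /intercept /slope /orient; field.
  by rewrite ba gt_eqF// subr_gt0.
- by rewrite line_left -above_line// ltW.
- by rewrite !line_right.
Qed.

Lemma measure_vertical_split (R : realType) (x : R) (S : set (R * R)) :
  measurable S -> mu2 S = (mu2 (S `&` [set p | (p.1 <= x)%R]) +
                           mu2 (S `&` [set p | (x <= p.1)%R]))%E.
Proof.
move=> mS.
have n0 : ((-1 : R) != 0) || ((0 : R) != 0) by rewrite oppr_eq0 oner_neq0.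
have -> : [set p : R * R | p.1 <= x] = [set p | 0 <= -1 * p.1 + 0 * p.2 + x].
  by apply/seteqP; split=> p /=; lra.
have -> : [set p : R * R | x <= p.1] = [set p | -1 * p.1 + 0 * p.2 + x <= 0].
  by apply/seteqP; split=> p /=; lra.
exact: measure_line_split n0 mS.
Qed.

(** Sorting three vertices by abscissa could reverse their orientation; a cyclic rotation cannot,
    and it is enough to put a leftmost vertex first. *)
Lemma leftmost_ind (R : realType) (P : R * R -> R * R -> R * R -> Prop) :
  (forall a b c, P b c a -> P a b c) ->
  (forall a b c, a.1 <= b.1 -> a.1 <= c.1 -> P a b c) -> forall a b c, P a b c.
Proof.
move=> Prot Pmin a b c.
have [ab|/ltW ba] := leP a.1 b.1.
  have [ac|/ltW ca] := leP a.1 c.1; first exact: Pmin.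
  by apply/Prot/Prot/Pmin => //; exact: le_trans ab.
have [bc|/ltW cb] := leP b.1 c.1; first exact/Prot/Pmin.
by apply/Prot/Prot/Pmin => //; exact: le_trans ba.
Qed.

Lemma measure_triangle (R : realType) (a b c : R * R) : 0 < orient a b c ->
  mu2 (triangle a b c) = (orient a b c / 2)%:E.
Proof.
move: a b c; apply: leftmost_ind => a b c.
  by rewrite (triangle_rot a) (orient_rot a).
move=> ab ac D; have [bc|/ltW cb] := leP b.1 c.1.
  have ltac : a.1 < c.1.
    rewrite lt_neqAle ac andbT; apply/eqP=> h.
    have ba : b.1 = a.1 by lra.
    by move: D; rewrite /orient -h ba; lra.
  rewrite (measure_vertical_split b.1 (@measurable_triangle _ a b c)).
  rewrite (triangle_left_below D ab bc ltac) (triangle_right_below D ab bc ltac).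
  by rewrite -EFinD; congr EFin; field; rewrite gt_eqF// subr_gt0.
have ltab : a.1 < b.1.
  rewrite lt_neqAle ab andbT; apply/eqP=> h.
  have ca : c.1 = a.1 by lra.
  by move: D; rewrite /orient -h ca; lra.
rewrite (measure_vertical_split c.1 (@measurable_triangle _ a b c)).
rewrite (triangle_left_above D ac cb ltab) (triangle_right_above D ac cb ltab).
by rewrite -EFinD; congr EFin; field; rewrite gt_eqF// subr_gt0.
Qed.

(** * Area of a convex polygon *)

(** Asking for all increasing triples, not only for sides, gives the sign of every diagonal and
    passes to initial segments. Indexing by [nat] avoids modular arithmetic; only values below [n]
    matter. *)
Definition ccw (R : realType) (n : nat) (P : nat -> R * R) :=
  forall i j k, (i < j)%N -> (j < k)%N -> (k < n)%N ->
  0 < orient (P i) (P j) (P k).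

(* Twice the area, by triangulation from the vertex P 0. *)
Definition fan (R : realType) (n : nat) (P : nat -> R * R) : R :=
  \sum_(1 <= i < n.-1) orient (P 0) (P i) (P i.+1).

Lemma orient_swap (R : realType) (a b c : R * R) :
  orient b a c = - orient a b c.
Proof. by rewrite /orient; ring. Qed.

(** The form [orient q r] is affine, so its value at [p] is the barycentric mean of its values at
    [a], [b], [c]. *)
Lemma barycentric (R : realType) (a b c q r p : R * R) :
  orient a b c * orient q r p = orient b c p * orient q r a +
    orient c a p * orient q r b + orient a b p * orient q r c.
Proof. by rewrite /orient; ring. Qed.

Lemma fst_comb (R : realType) (n : nat) (w : 'I_n -> R) (A : 'I_n -> R * R) :
  (\sum_i w i *: A i).1 = \sum_i w i * (A i).1.
Proof. by apply: (big_ind2 (fun (x : R * R) y => x.1 = y)) => //= ? ? ? ? -> ->. Qed.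

Lemma snd_comb (R : realType) (n : nat) (w : 'I_n -> R) (A : 'I_n -> R * R) :
  (\sum_i w i *: A i).2 = \sum_i w i * (A i).2.
Proof. by apply: (big_ind2 (fun (x : R * R) y => x.2 = y)) => //= ? ? ? ? -> ->. Qed.

Lemma orient_comb (R : realType) (n : nat) (w : 'I_n -> R) (A : 'I_n -> R * R)
    (q r : R * R) : \sum_i w i = 1 ->
  orient q r (\sum_i w i *: A i) = \sum_i w i * orient q r (A i).
Proof.
move=> w1; rewrite orient_affine fst_comb snd_comb -[X in _ + _ + X]mulr1 -w1.
rewrite !mulr_sumr -!big_split /=; apply: eq_bigr => i _.
by rewrite orient_affine; ring.
Qed.

Lemma triangle_region (R : realType) (n : nat) (A : 'I_n -> R * R)
    (i j k : 'I_n) : 0 < orient (A i) (A j) (A k) ->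
  triangle (A i) (A j) (A k) `<=` polygon_region A.
Proof.
set D := orient _ _ _ => D0 p [pij pjk pki].
(* The barycentric coordinates of [p], written as a sum of three indicator terms so that [comb] can
   split the sum. *)
pose w (l : 'I_n) : R := (if l == i then orient (A j) (A k) p / D else 0) +
  ((if l == j then orient (A k) (A i) p / D else 0) +
   (if l == k then orient (A i) (A j) p / D else 0)).
have comb (V : lmodType R) (F : 'I_n -> V) : \sum_l w l *: F l =
    (orient (A j) (A k) p / D) *: F i +
    ((orient (A k) (A i) p / D) *: F j + (orient (A i) (A j) p / D) *: F k).
  have one x (l : 'I_n) : \sum_m (if m == l then x else 0) *: F m = x *: F l.
    rewrite (bigD1 l)//= eqxx big1 ?addr0// => m /negPf ->.
    by rewrite scale0r.
  by under eq_bigr do rewrite !scalerDl; rewrite !big_split /= !one.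
exists w; split.
- by move=> l; rewrite /w !addr_ge0//; case: ifP => _ //;
    rewrite divr_ge0// ltW.
- have := comb R^o (fun=> 1); rewrite /GRing.scale /=.
  under eq_bigr do rewrite mulr1.
  move=> ->; rewrite !mulr1 -!mulrDl -[RHS](@divff _ D) ?gt_eqF//.
  by congr (_ / _); rewrite /D /orient; ring.
- rewrite comb; apply/eqP; rewrite -pair_eqE /= /GRing.scale /=.
  have Dn0 : D != 0 by rewrite gt_eqF.
  have DK x y : D * (x / D * y) = x * y by rewrite mulrA [D * _]mulrC divfK.
  by apply/andP; split; apply/eqP; apply: (mulfI Dn0);
    rewrite !mulrDr !DK /D /orient; ring.
Qed.

(** A discrete intermediate value theorem; it selects the fan triangle that contains a given
    point. *)
Lemma sign_change (R : realType) (f : nat -> R) (m : nat) :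
  0 <= f 1%N -> f m.+2 <= 0 ->
  exists i, [/\ (0 < i)%N, (i < m.+2)%N, 0 <= f i & f i.+1 <= 0].
Proof.
move=> f1; elim: m => [|m IH] fm; first by exists 1%N.
have [h|/ltW h] := leP (f m.+2) 0; last by exists m.+2.
by have [i [? ? ? ?]] := IH h; exists i; split => //; exact: ltnW.
Qed.

(** A convex combination of the vertices is on the left of every side. Seen from [P 0], it is on the
    left of [P 1] and on the right of the last vertex, so a sign change places it between some [P i]
    and [P i.+1]. Conversely, each triangle lies in the hull. *)
Lemma polygon_regionE (R : realType) (n : nat) (P : nat -> R * R) :
  (3 <= n)%N -> ccw n P ->
  polygon_region (fun i : 'I_n => P i) =
  \bigcup_(i in [set i | (0 < i < n.-1)%N]) triangle (P 0) (P i) (P i.+1).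
Proof.
case: n => [|[|[|n]]]// _ cP; apply/seteqP; split=> p /=.
  case=> w [w0 w1 ->]; set p' := \sum_i _.
  have side q r : (forall i : 'I_n.+3, 0 <= orient q r (P i)) -> 0 <= orient q r p'.
    by move=> h; rewrite orient_comb//; apply: sumr_ge0 => i _; rewrite mulr_ge0.
  have edge i : (i < n.+2)%N -> 0 <= orient (P i) (P i.+1) p'.
    move=> lin; apply: side => -[j /= jn].
    have [ji|ij|->] := ltngtP j i.
    - by rewrite 2!orient_rot orient_rot -orient_rot ltW// cP.
    - move: ij; rewrite leq_eqVlt => /predU1P[<-|ij].
        by rewrite /orient; lra.
      by rewrite ltW// cP.
    - by rewrite /orient; lra.
  have last : orient (P 0%N) (P n.+2) p' <= 0.
    rewrite -oppr_ge0 -orient_swap; apply: side => -[[|j] /= jn].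
      by rewrite /orient; lra.
    move: jn; rewrite ltnS leq_eqVlt => /predU1P[[->]|jn].
      by rewrite /orient; lra.
    by rewrite orient_rot ltW// cP.
  have [i [i0 il h1 h2]] := @sign_change _
    (fun i => orient (P 0%N) (P i) p') n (edge 0%N isT) last.
  exists i; first by rewrite /= i0.
  by split => //; [exact: edge | rewrite orient_swap oppr_ge0].
case=> i /andP[i0 il]; move: p.
have iln : (i < n.+3)%N by exact: ltnW.
exact: (@triangle_region _ _ (fun i : 'I_n.+3 => P i) ord0 (Ordinal iln)
  (Ordinal (il : (i.+1 < n.+3)%N)) (cP _ _ _ i0 (ltnSn i) il)).
Qed.

Lemma measure_setU_line (R : realType) (u v w : R) (A B : set (R * R)) :
  (u != 0) || (v != 0) -> measurable A -> measurable B -> (mu2 A < +oo)%E ->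
  A `&` B `<=` [set p | u * p.1 + v * p.2 + w = 0] ->
  mu2 (A `|` B) = (mu2 A + mu2 B)%E.
Proof.
move=> uv mA mB fA AB; rewrite measureUfinl; [|exact: mA|exact: mB|exact: fA].
rewrite [X in (_ - X)%E](_ : _ = 0%E) ?sube0//.
apply: subset_measure0 (line_null w uv).
- exact: measurableI.
- exact: measurable_line.
- exact: AB.
Qed.

Lemma orient_neq0_line (R : realType) (a b c : R * R) : 0 < orient a b c ->
  (a.2 - b.2 != 0) || (b.1 - a.1 != 0).
Proof.
move=> D; apply/norP => -[/negPn/eqP h1 /negPn/eqP h2].
by move: D; rewrite orient_affine h2 -[b.2 - _]opprB h1; lra.
Qed.

(** Induction on [k]: the earlier triangles have their vertices on or to the right of the line from
    [P 0] to [P k], the new one lies on its left, so they meet in a null set. *)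
Lemma measure_fan (R : realType) (n : nat) (P : nat -> R * R) (k : nat) :
  ccw n P -> (k < n)%N ->
  measurable (\bigcup_(i in [set i | (0 < i < k)%N])
    triangle (P 0) (P i) (P i.+1)) /\
  mu2 (\bigcup_(i in [set i | (0 < i < k)%N]) triangle (P 0) (P i) (P i.+1)) =
  ((\sum_(1 <= i < k) orient (P 0) (P i) (P i.+1)) / 2)%:E.
Proof.
move=> cP; elim: k => [_|k IH kn].
  rewrite big_geq// mul0r (_ : [set i | _] = set0) ?bigcup_set0 ?measure0//.
  by apply/seteqP; split=> i //= /andP[].
have [->|k0] := posnP k.
  rewrite big_geq// mul0r (_ : [set i | _] = set0) ?bigcup_set0 ?measure0//.
  by apply/seteqP; split=> i //= /andP[]; case: i.
have [mU muU] := IH (ltnW kn).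
rewrite (_ : [set i | _] = [set i | (0 < i < k)%N] `|` [set k]); last first.
  apply/seteqP; split=> i /=.
    by rewrite ltnS [(i <= k)%N]leq_eqVlt => /andP[i0 /predU1P[->|ik]];
      [right | left; rewrite i0].
  by case=> [/andP[-> /ltnW] //|->]; rewrite k0 ltnSn.
rewrite bigcup_setU bigcup_set1; set U := \bigcup_(i in _) _ in mU muU *.
have mT := measurable_triangle (P 0%N) (P k) (P k.+1).
split; first exact: measurableU.
have D : 0 < orient (P 0%N) (P k) (P k.+1) by exact: cP.
have nz := orient_neq0_line D.
rewrite (measure_setU_line (w := (((P k).2 - (P 0%N).2) * (P 0%N).1 -
  ((P k).1 - (P 0%N).1) * (P 0%N).2)) nz mU mT).
- rewrite muU (measure_triangle D) -EFinD; congr EFin.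
  by rewrite [in RHS]big_nat_recr//= [RHS]mulrDl.
- by rewrite muU ltry.
- move=> p [[i /= /andP[i0 ik] [h1 h2 h3]] [h _ _]].
  rewrite /= -orient_affine; apply/eqP; rewrite eq_le h andbT.
  have Di : 0 < orient (P 0%N) (P i) (P i.+1).
    by apply: cP => //; exact: leq_ltn_trans (ltnW kn).
  rewrite -(pmulr_rle0 _ Di) (barycentric _ _ _ (P 0%N)).
  have o0 : orient (P 0%N) (P k) (P 0%N) = 0 by rewrite /orient; ring.
  have oi : orient (P 0%N) (P k) (P i) <= 0.
    by rewrite orient_rot orient_swap -orient_rot oppr_le0 ltW// cP// ltnW.
  have oi1 : orient (P 0%N) (P k) (P i.+1) <= 0.
    move: ik; rewrite leq_eqVlt => /predU1P[->|ik].
      by rewrite /orient; lra.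
    by rewrite orient_rot orient_swap -orient_rot oppr_le0 ltW// cP// ltnW.
  by rewrite o0; nra.
Qed.

Lemma area_polygon (R : realType) (n : nat) (P : nat -> R * R) :
  (3 <= n)%N -> ccw n P -> area (fun i : 'I_n => P i) = fan n P / 2.
Proof.
move=> n3 cP; rewrite /area (polygon_regionE n3 cP).
have [|_ ->] := @measure_fan _ n P n.-1 cP; last by [].
by case: n n3 {cP}.
Qed.

(** * Kasner descendants *)

(** Twice the signed area of the triangle formed with the origin: the summand of the shoelace
    formula. *)
Definition cross (R : realType) (a b : R * R) : R := a.1 * b.2 - a.2 * b.1.

(* The two triangles that wrap around are written separately because P need not
   be n-periodic. *)
Definition corners (R : realType) (n : nat) (P : nat -> R * R) : R :=
  \sum_(0 <= i < n.-2) orient (P i) (P i.+1) (P i.+2) +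
  orient (P n.-2) (P n.-1) (P 0) + orient (P n.-1) (P 0) (P 1).

(* The closing side is not needed: seen from P i, the later vertices lie on one
   side of the line P i P i.+1 and turn counterclockwise. *)
Lemma ccw_of_edges (R : realType) (n : nat) (P : nat -> R * R) :
  (forall i j, (i.+1 < n)%N -> (j < n)%N -> j != i -> j != i.+1 ->
     0 < orient (P i) (P i.+1) (P j)) ->
  ccw n P.
Proof.
move=> edge i j k ij; elim: k => // k IH; rewrite ltnS => jk kn.
have ik : (i < k)%N by exact: leq_trans jk.
have D : 0 < orient (P i) (P k) (P k.+1).
  by rewrite orient_rot; apply: edge; lia.
move: jk; rewrite leq_eqVlt => /predU1P[->//|jk].
have Djk := IH jk (ltnW kn).
have side l : (i.+1 < l)%N -> (l < n)%N -> 0 < orient (P i) (P i.+1) (P l).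
  by move=> il ln; apply: edge; lia.
have [->|ij1] := eqVneq j i.+1; first by apply: side; lia.
have sj : 0 < orient (P i) (P i.+1) (P j) by apply: side; lia.
have sk : 0 < orient (P i) (P i.+1) (P k) by apply: side; lia.
have sk1 : 0 < orient (P i) (P i.+1) (P k.+1) by apply: side; lia.
rewrite -(pmulr_rgt0 _ sk).
have -> : orient (P i) (P i.+1) (P k) * orient (P i) (P j) (P k.+1) =
  orient (P i) (P i.+1) (P j) * orient (P i) (P k) (P k.+1) +
  orient (P i) (P i.+1) (P k.+1) * orient (P i) (P j) (P k).
  by rewrite /orient; ring.
by rewrite addr_gt0// mulr_gt0.
Qed.

Lemma convex_polygon_ccw (R : realType) (n : nat) (K : 'I_n -> R * R) :
  convex_polygon K ->
  exists P : nat -> R * R, ccw n P /\ K = (fun i : 'I_n => P i).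
Proof.
(* Outside the range the value is the default [0], which [ccw n] never reads. *)
case=> n3 edge; pose P k := if insub k is Some i then K i else 0.
have PE (i : 'I_n) : P i = K i by rewrite /P valK.
exists P; split; last by apply/funext => i; rewrite PE.
apply: ccw_of_edges => i j i1n jn ji ji1.
have := edge (Ordinal (ltnW i1n)) (Ordinal jn); rewrite -!PE /= modn_small//.
by apply=> //; rewrite -val_eqE /= modn_small.
Qed.

Lemma ccw_convex_polygon (R : realType) (n : nat) (P : nat -> R * R) :
  (3 <= n)%N -> ccw n P -> convex_polygon (fun i : 'I_n => P i).
Proof.
move=> n3 cP; split=> // -[i iln] [j jn]; rewrite -!val_eqE /= => ji.
have [i1n|] := ltnP i.+1 n.
  rewrite modn_small// => ji1; have [lt|gt|eq] := ltngtP j i.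
  - by rewrite -orient_rot cP.
  - by apply: cP; lia.
  - by rewrite eq eqxx in ji.
(* The closing side ends at [P 0]; rotating the triple puts its indices in increasing order. *)
move=> ni; have {ni}in1 : i.+1 = n by apply/eqP; rewrite eqn_leq iln.
rewrite in1 modnn => j0; rewrite orient_rot; apply: cP; lia.
Qed.

(** Covers the triples met in [ccw_kasner], whose indices may coincide or reach [n]; coinciding
    vertices give orientation zero. *)
Lemma ccw_weak (R : realType) (n : nat) (P : nat -> R * R) (i j k : nat) :
  ccw n P -> P n = P 0%N -> (i <= j)%N -> (j <= k)%N -> (k <= n)%N ->
  0 <= orient (P i) (P j) (P k).
Proof.
move=> cP Pn; rewrite leq_eqVlt => /predU1P[<- _ _|ij].
  by rewrite /orient; lra.
rewrite leq_eqVlt => /predU1P[<- _|jk]; first by rewrite /orient; lra.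
rewrite leq_eqVlt => /predU1P[kn|kn]; last by rewrite ltW// cP.
rewrite kn Pn -orient_rot; have [->|i0] := posnP i.
  by rewrite /orient; lra.
by rewrite ltW// cP// -kn.
Qed.

(** Since [orient] is affine in each vertex, the orientation of three descendants is a convex
    combination of eight orientations of vertices of [P]. All are nonnegative by [ccw_weak], and the
    one at [i], [j], [k] is positive. *)
Lemma ccw_kasner (R : realType) (n : nat) (P : nat -> R * R) (m : R) :
  0 < m < 1 -> ccw n P -> P n = P 0%N ->
  ccw n (fun k => P k + m *: (P k.+1 - P k)).
Proof.
move=> /andP[m0 m1] cP Pn i j k ij jk kn.
have ik := ltn_trans ij jk.
have w i' j' k' := @ccw_weak _ _ _ i' j' k' cP Pn.
pose l := 1 - m; have l0 : 0 < l by rewrite subr_gt0.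
have -> : orient (P i + m *: (P i.+1 - P i)) (P j + m *: (P j.+1 - P j))
    (P k + m *: (P k.+1 - P k)) =
  l * l * l * orient (P i) (P j) (P k) +
  (l * l * m * orient (P i) (P j) (P k.+1) +
   l * m * l * orient (P i) (P j.+1) (P k) +
   l * m * m * orient (P i) (P j.+1) (P k.+1) +
   m * l * l * orient (P i.+1) (P j) (P k) +
   m * l * m * orient (P i.+1) (P j) (P k.+1) +
   m * m * l * orient (P i.+1) (P j.+1) (P k) +
   m * m * m * orient (P i.+1) (P j.+1) (P k.+1)).
  by rewrite /orient /l /= /GRing.scale /=; ring.
apply: ltr_wpDr; last by rewrite !mulr_gt0// cP.
have m0' := ltW m0; have l0' := ltW l0.
by rewrite !addr_ge0// !mulr_ge0// w// ltnW// ltnW.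
Qed.

(** The terms along the diagonals from [P 0] cancel between neighbouring fan triangles, leaving the
    sides. *)
Lemma fan_shoelace (R : realType) (n : nat) (P : nat -> R * R) :
  (2 <= n)%N -> P n = P 0%N ->
  fan n P = \sum_(0 <= i < n) cross (P i) (P i.+1).
Proof.
case: n => [|[|n]]// _; rewrite big_nat_recr//= => ->.
elim: n => [|n IH].
  by rewrite big_nat1 /fan big_geq// /cross; ring.
rewrite /fan big_nat_recr//= [X in X + _]IH [in RHS]big_nat_recr//= /orient /cross.
by rewrite -!addrA; congr (_ + _); ring.
Qed.

Lemma corners_cyclic (R : realType) (n : nat) (P : nat -> R * R) :
  (2 <= n)%N -> P n = P 0%N -> P n.+1 = P 1%N ->
  corners n P = \sum_(0 <= i < n) orient (P i) (P i.+1) (P i.+2).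
Proof.
by case: n => [|[|n]]// _ h h'; rewrite /corners !big_nat_recr//= h h'.
Qed.

Lemma fan_kasner (R : realType) (n : nat) (P : nat -> R * R) (m : R) :
  (2 <= n)%N -> P n = P 0%N -> P n.+1 = P 1%N ->
  fan n (fun k => P k + m *: (P k.+1 - P k)) =
  fan n P - m * (1 - m) * corners n P.
Proof.
move=> n2 Pn Pn1; rewrite !fan_shoelace// ?Pn ?Pn1// corners_cyclic//.
(* Each shoelace summand of the descendant is [(1 - m) * c i + m * c i.+1] minus [m * (1 - m)] times
   a corner; the cyclic shift sums the first part to [fan n P]. *)
pose c i := cross (P i) (P i.+1).
have shift : \sum_(0 <= i < n) c i.+1 = \sum_(0 <= i < n) c i.
  have n0 : (0 < n)%N by exact: ltnW.
  rewrite -(big_add1 _ _ 0 n.+1 xpredT c) /= big_nat_recr//= [RHS]big_ltn//.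
  by rewrite addrC /c Pn Pn1.
have <- : \sum_(0 <= i < n) ((1 - m) * c i + m * c i.+1) =
    \sum_(0 <= i < n) c i.
  by rewrite big_split /= -!mulr_sumr shift; ring.
rewrite mulr_sumr -sumrB; apply: eq_bigr => i _.
by rewrite /c /cross /orient /= /GRing.scale /=; ring.
Qed.

(** * The sum of the corner triangles *)

(* Seen from r, the triangles s p r and t q r overlap and together cover s q r. *)
Lemma pentagon (R : realType) (s t p q r : R * R) :
  0 < orient s t q -> 0 < orient s p q -> 0 < orient s q r ->
  0 < orient s t r -> 0 < orient s p r -> 0 < orient t p r ->
  0 < orient t q r -> 0 < orient p q r ->
  orient s q r < orient s p r + orient t q r.
Proof.
move=> stq spq sqr str spr tpr tqr pqr; rewrite ltNge; apply/negP => h.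
(* Under [h], the two cocycle relations force [orient s t r] above [orient s p r] and [orient p q r]
   above [orient t q r], which contradicts the positive right-hand side of this Plücker relation. *)
have pluecker : orient s q r * orient t p r =
    orient t q r * orient s p r - orient s t r * orient p q r.
  by rewrite /orient; ring.
have cocycle_t : orient s t q = orient t q r + orient s t r - orient s q r.
  by rewrite /orient; ring.
have cocycle_p : orient s p q = orient s p r + orient p q r - orient s q r.
  by rewrite /orient; ring.
have : 0 < orient s q r * orient t p r by exact: mulr_gt0.
rewrite pluecker subr_gt0; apply/negP; rewrite -leNgt mulrC.
by apply: ler_pM; lra.
Qed.

Lemma corners_lt (R : realType) (n : nat) (P : nat -> R * R) :
  (5 <= n)%N -> ccw n P -> corners n P < 2 * fan n P.
Proof.
case: n => [|[|[|[|[|k]]]]]// _.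
have step n : ccw n.+3 P -> (2 <= n)%N -> corners n.+2 P <= 2 * fan n.+2 P ->
    corners n.+3 P < 2 * fan n.+3 P.
  move=> cP n2; rewrite /corners /fan /= !big_nat_recr ?(ltnW n2)//=.
  (* The pentagon consists of the new vertex [P n.+2] and its two neighbours on either side, the
     only vertices whose corner triangles change or border a change; [2 <= n] keeps the five
     distinct. *)
  have h : orient (P 0%N) (P n.+1) (P n.+2) < orient (P 0%N) (P n) (P n.+2) +
      orient (P 1%N) (P n.+1) (P n.+2).
    by apply: pentagon; apply: cP; lia.
  suff : orient (P n) (P n.+1) (P n.+2) - orient (P n) (P n.+1) (P 0%N)
     + orient (P n.+2) (P 0%N) (P 1%N) - orient (P n.+1) (P 0%N) (P 1%N)
     + orient (P n.+1) (P n.+2) (P 0%N) < 2 * orient (P 0%N) (P n.+1) (P n.+2).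
    by lra.
  by move: h; rewrite /orient; lra.
elim: k => [|k IH] cP.
  (* The quadrilateral gives equality; passing to five vertices makes the inequality strict. *)
  apply: step => //; rewrite /corners /fan /index_iota /= !big_cons !big_nil.
  by rewrite /orient; lra.
by apply: step => //; apply/ltW/IH => i j l *; apply: cP => //; exact: ltnW.
Qed.

Lemma corners_gt0 (R : realType) (n : nat) (P : nat -> R * R) :
  (3 <= n)%N -> ccw n P -> 0 < corners n P.
Proof.
case: n => [|[|[|n]]]// _ cP; rewrite /corners.
have h1 : 0 < orient (P n.+1) (P n.+2) (P 0%N) by rewrite -orient_rot cP.
have h2 : 0 < orient (P n.+2) (P 0%N) (P 1%N) by rewrite orient_rot cP.
apply: addr_gt0 h2; apply: ltr_wpDl h1.
by rewrite big_nat sumr_ge0// => i /andP[_ ?]; apply/ltW/cP; lia.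
Qed.

Lemma fan_gt0 (R : realType) (n : nat) (P : nat -> R * R) :
  (3 <= n)%N -> ccw n P -> 0 < fan n P.
Proof.
case: n => [|[|[|n]]]// _ cP; rewrite /fan /= big_nat_recr//=.
apply: ltr_wpDl (cP 0%N n.+1 n.+2 _ _ _) => //.
by rewrite big_nat sumr_ge0// => i /andP[? ?]; apply/ltW/cP; lia.
Qed.

Lemma kasner_ratio (R : realType) (n : nat) (P : nat -> R * R) (m : R) :
  0 < m < 1 -> (3 <= n)%N -> ccw n P ->
  area (kasner m (fun i : 'I_n => P i)) / area (fun i : 'I_n => P i) =
  1 - m * (1 - m) * (corners n P / fan n P).
Proof.
move=> m01 n3 cP; pose P' k := P (k %% n)%N.
have P'E k : (k < n)%N -> P' k = P k by move=> kn; rewrite /P' modn_small.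
have cP' : ccw n P' by move=> i j k *; rewrite !P'E ?cP//; lia.
have P'n : P' n = P' 0%N by rewrite /P' modnn mod0n.
have P'n1 : P' n.+1 = P' 1%N by rewrite /P' -addn1 modnDl.
have -> : kasner m (fun i : 'I_n => P i) =
    (fun i : 'I_n => P' i + m *: (P' i.+1 - P' i)).
  by apply/funext => i; rewrite /kasner P'E.
have fanE : fan n P' = fan n P.
  by apply: eq_big_nat => i ?; rewrite !P'E//; lia.
have cornersE : corners n P' = corners n P.
  rewrite /corners !P'E//; try lia.
  by congr (_ + _ + _); apply: eq_big_nat => i ?; rewrite !P'E//; lia.
rewrite (area_polygon n3 (ccw_kasner m01 cP' P'n)) (area_polygon n3 cP).
rewrite fan_kasner// ?fanE ?cornersE; last exact: ltnW.
by field; rewrite gt_eqF// fan_gt0.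
Qed.

(** * Extremal polygons *)

(** Increasing parameters automatically give a convex polygon, and orientations become Vandermonde
    products. *)
Definition parabola (R : realType) (t : nat -> R) (k : nat) : R * R :=
  (t k, t k ^+ 2).

Lemma orient_parabola (R : realType) (t : nat -> R) (i j k : nat) :
  orient (parabola t i) (parabola t j) (parabola t k) =
  (t j - t i) * (t k - t i) * (t k - t j).
Proof. by rewrite /orient /=; ring. Qed.

Lemma ccw_parabola (R : realType) (n : nat) (t : nat -> R) :
  (forall i, (i.+1 < n)%N -> t i < t i.+1) -> ccw n (parabola t).
Proof.
move=> ht.
have {}ht i j : (i < j)%N -> (j < n)%N -> t i < t j.
  elim: j => // j IH; rewrite ltnS leq_eqVlt => /predU1P[->|ij] jn.
    exact: ht.
  exact: lt_trans (IH ij (ltnW jn)) (ht j jn).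
move=> i j k ij jk kn; rewrite orient_parabola !mulr_gt0// subr_gt0 ht//; lia.
Qed.

(** The polygon is inscribed in the parabolic segment cut off by a chord from the origin, whose
    doubled area is the bound. In the induction this reads [0 <= (b - a) ^+ 3]. *)
Lemma fan_parabola_le (R : realType) (t : nat -> R) (k : nat) :
  t 0%N = 0 -> (forall i, (i <= k)%N -> t i < t i.+1) ->
  \sum_(1 <= i < k.+1) orient (parabola t 0) (parabola t i) (parabola t i.+1) <=
  t k.+1 ^+ 3 / 3.
Proof.
move=> t0; elim: k => [|k IH] ht.
  by have := ht 0%N isT; rewrite big_geq// t0 => t1; rewrite divr_ge0// exprn_ge0// ltW.
rewrite big_nat_recr//= orient_parabola t0 !subr0.
have {}IH := IH (fun i ik => ht i (leqW ik)).
have := ht k.+1 (leqnn _); set a := t k.+1 in IH *; set b := t k.+2 => ab.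
have : 0 <= (b - a) ^+ 3 by rewrite exprn_ge0// subr_ge0 ltW.
by lra.
Qed.

(** The parameters are [0], ..., [k], then [M] and [M ^+ 2]. The corners at the last two vertices
    and the whole fan all have leading term [M ^+ 5], so the ratio tends to 2. *)
Lemma polygon_large_corners (R : realType) (n : nat) (e : R) :
  (4 <= n)%N -> 0 < e ->
  exists P : nat -> R * R, ccw n P /\ (2 - e) * fan n P < corners n P.
Proof.
case: n => [|[|[|k]]]// _ e0; pose c : R := 2 * k%:R + 3.
have k0 : 0 <= k%:R :> R by [].
have c0 : 0 < c / e by rewrite divr_gt0// /c; lra.
(* The loss [2 * k%:R * M ^+ 2 * (M ^+ 2 - M) + 2 * S] is below [c * M ^+ 4] and must stay below
   [e * (M - 1) * M ^+ 4]; hence the term [c / e]. The rest keeps [M] beyond the cluster. *)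
pose M : R := k%:R + 2 + c / e.
pose t i : R := if (i <= k)%N then i%:R else if i == k.+1 then M else M ^+ 2.
have tk : t k = k%:R by rewrite /t leqnn.
have tk1 : t k.+1 = M by rewrite /t ltnn eqxx.
have tk2 : t k.+2 = M ^+ 2 by rewrite /t ltnNge leqnSn /= gtn_eqF.
have kM : k%:R + 2 < M by rewrite /M; lra.
have tS i : (i.+1 < k.+3)%N -> t i < t i.+1.
  rewrite ltnS leq_eqVlt => /predU1P[[->]|]; first by rewrite tk1 tk2; nra.
  rewrite ltnS leq_eqVlt => /predU1P[[->]|]; first by rewrite tk1 tk; lra.
  by move=> ik; rewrite /t (ik : (i.+1 <= k)%N) (ltnW ik : (i <= k)%N) ltr_nat.
have cP := ccw_parabola tS.
exists (parabola t); split=> //.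
have t0 : t 0%N = 0 by rewrite /t.
pose S := \sum_(1 <= i < k.+1) orient (parabola t 0) (parabola t i) (parabola t i.+1).
have S0 : 0 <= S.
  by rewrite /S big_nat sumr_ge0// => i /andP[? ?]; apply/ltW/cP; lia.
have SM : S <= M ^+ 3 / 3.
  by rewrite -tk1; apply: fan_parabola_le => // i ik; apply: tS; lia.
have fanE : fan k.+3 (parabola t) = S + M * M ^+ 2 * (M ^+ 2 - M).
  by rewrite /fan big_nat_recr//= orient_parabola t0 tk1 tk2 !subr0.
have cornersE : (M - k%:R) * (M ^+ 2 - k%:R) * (M ^+ 2 - M) +
    M * M ^+ 2 * (M ^+ 2 - M) <= corners k.+3 (parabola t).
  rewrite /corners /= big_nat_recr//= !orient_parabola t0 tk tk1 tk2.
  set T := \sum_(_ <= _ < _) _.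
  have T0 : 0 <= T.
    by rewrite /T big_nat sumr_ge0// => i /andP[? ?]; apply/ltW/cP; lia.
  have : 0 < orient (parabola t k.+2) (parabola t 0) (parabola t 1).
    by rewrite orient_rot; apply: cP; lia.
  by rewrite orient_parabola t0 tk2; lra.
apply: lt_le_trans cornersE; rewrite fanE.
have M1 : 1 <= M by lra.
have M3 : 0 <= M ^+ 3 by rewrite exprn_ge0//; lra.
have M4 : 0 < M ^+ 4 by rewrite exprn_gt0//; lra.
have M34 : M ^+ 3 <= M ^+ 4 by rewrite [M ^+ 4]exprS ler_peMl.
have h1 : M ^+ 3 - 2 * k%:R * M ^+ 2 <= (M - k%:R) * (M ^+ 2 - k%:R).
  have : 0 <= k%:R * (M ^+ 2 - M) by rewrite mulr_ge0//; nra.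
  by have := sqr_ge0 (k%:R : R); lra.
have h2 : (M ^+ 3 - 2 * k%:R * M ^+ 2) * (M ^+ 2 - M) <=
    (M - k%:R) * (M ^+ 2 - k%:R) * (M ^+ 2 - M).
  by rewrite ler_wpM2r//; nra.
have h3 : c * M ^+ 4 <= e * (M - 1) * M ^+ 4.
  rewrite ler_wpM2r ?(ltW M4)// mulrC -ler_pdivrMr// /M; lra.
have h4 : 0 <= e * S by rewrite mulr_ge0// ltW.
have h5 : 0 <= k%:R * M ^+ 3 by exact: mulr_ge0.
by rewrite /c in h3; lra.
Qed.

(** One unit gap makes a corner triangle quadratic, instead of cubic, in the spread of its
    parameters. *)
Lemma gap_product_le (R : realType) (a b c B : R) :
  a <= b -> b <= c -> c - a <= B -> b - a = 1 \/ c - b = 1 -> 1 <= B ->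
  (b - a) * (c - a) * (c - b) <= B ^+ 2.
Proof.
move=> ab bc acB h B1; rewrite expr2.
have {h} : (b - a) * (c - b) <= B.
  by case: h => ->; rewrite ?mul1r ?mulr1; lra.
have ca0 : 0 <= c - a by lra.
move=> h; rewrite mulrAC; apply: ler_pM => //; apply: mulr_ge0; lra.
Qed.

(** The clusters have indices 0 and 1, 2 and 3, and 4 onwards. As [6 <= n], each has at least two
    vertices, so three cyclically consecutive vertices always include a unit gap and each corner is
    of order [M ^+ 2]. The fan triangle 0, 3, 4 joins all three clusters and has order [M ^+ 3]. *)
Lemma polygon_small_corners (R : realType) (n : nat) (e : R) :
  (6 <= n)%N -> 0 < e ->
  exists P : nat -> R * R, ccw n P /\ corners n P < e * fan n P.
Proof.
case: n => [|[|[|[|[|[|k]]]]]]// _ e0; set n := k.+4.+2.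
(* Parameters stay below [3 * M], so the [n] corners total at most [9 * n%:R * M ^+ 2], and
   [9 * n%:R <= e * M] compares this with the fan. *)
pose M : R := n%:R + 9 * n%:R / e.
pose t i : R := i%:R + ((1 < i)%N + (3 < i)%N)%:R * M.
have n1 : 1 <= n%:R :> R by rewrite ler1n.
have nM : n%:R < M by rewrite /M ltrDl divr_gt0//; lra.
have tS i : t i + 1 <= t i.+1.
  have : ((1 < i)%N + (3 < i)%N)%:R * M <= ((1 < i.+1)%N + (3 < i.+1)%N)%:R * M.
    by rewrite ler_wpM2r ?ler_nat; [|lra|lia].
  by rewrite /t -[i.+1%:R]natr1; lra.
have tS1 i : (i != 1)%N -> (i != 3)%N -> t i.+1 - t i = 1.
  move=> i1 i3; rewrite /t (_ : (1 < i.+1) = (1 < i))%N; last by lia.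
  by rewrite (_ : (3 < i.+1) = (3 < i))%N; [rewrite -[i.+1%:R]natr1; ring | lia].
have cP : ccw n (parabola t) by apply: ccw_parabola => i _; have := tS i; lra.
exists (parabola t); split=> //.
have t0 : t 0%N = 0 by rewrite /t mul0r addr0.
have t1 : t 1%N = 1 by rewrite /t mul0r addr0.
have tle i : (i < n)%N -> t i <= 3 * M.
  move=> lin; have : i%:R <= n%:R :> R by rewrite ler_nat ltnW.
  have : ((1 < i)%N + (3 < i)%N)%:R * M <= 2 * M.
    by rewrite ler_wpM2r ?(ler_nat _ _ 2); [|lra|lia].
  by rewrite /t; lra.
have tge0 i : 0 <= t i.
  by rewrite /t addr_ge0// mulr_ge0//; lra.
have M9 : 1 <= 3 * M by lra.
have pos i j l : (i < j)%N -> (j < l)%N -> (l < n)%N ->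
    0 <= orient (parabola t i) (parabola t j) (parabola t l).
  by move=> ij jl ln; apply/ltW/cP.
have fan_ge : 2 * M ^+ 3 <= fan n (parabola t).
  rewrite /fan /n /= big_ltn// big_ltn// big_ltn//.
  have t3 : t 3%N = 3 + M by rewrite /t mul1r.
  have t4 : t 4%N = 4 + 2 * M by rewrite /t.
  have p2 := pos 0%N 1%N 2%N isT isT isT.
  have p3 := pos 0%N 2%N 3%N isT isT isT.
  have p4 : 2 * M ^+ 3 <= orient (parabola t 0) (parabola t 3) (parabola t 4).
    have M0 : 0 < M by lra.
    have M3 : 0 < M ^+ 2 by rewrite exprn_gt0.
    by rewrite orient_parabola t0 t3 t4; lra.
  set T := \sum_(_ <= _ < _) _.
  have T0 : 0 <= T.
    by rewrite /T big_nat sumr_ge0// => i /andP[? ?]; apply: pos; lia.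
  by lra.
have corner_le i : (i.+2 < n)%N ->
    orient (parabola t i) (parabola t i.+1) (parabola t i.+2) <= (3 * M) ^+ 2.
  move=> lin; rewrite orient_parabola.
  have h1 := tS i; have h2 := tS i.+1; have h3 := tle _ lin; have h4 := tge0 i.
  apply: gap_product_le => //; try lra.
  (* Long gaps occur only after indices 1 and 3, and the gap following a long one is inside a
     cluster. *)
  have [|i1] := boolP ((i != 1)%N && (i != 3)%N).
    by case/andP => ? ?; left; exact: tS1.
  by right; apply: tS1; lia.
have corners_le : corners n (parabola t) <= n%:R * (3 * M) ^+ 2.
  have l1 : orient (parabola t n.-2) (parabola t n.-1) (parabola t 0) <= (3 * M) ^+ 2.
    rewrite -orient_rot orient_parabola [_ * (t n.-1 - t n.-2)]mulrC mulrA.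
    (* Here [n.-2] is at least 4, so the last two vertices share the third cluster. *)
    have h1 : t n.-1 - t n.-2 = 1 by apply: tS1.
    have h2 := tle n.-1 (leqnn n); have h3 := tle n.-2 (leqnSn _).
    have h4 := tge0 n.-1; have h5 := tge0 n.-2.
    rewrite t0 h1 !subr0 mul1r expr2; exact: ler_pM.
  have l2 : orient (parabola t n.-1) (parabola t 0) (parabola t 1) <= (3 * M) ^+ 2.
    rewrite orient_rot orient_parabola t0 t1 !subr0 mul1r.
    have h2 := tle n.-1 (leqnn n); have h3 := tS 0%N.
    have h4 : 1 <= t n.-1.
      have : 1 <= n.-1%:R :> R by rewrite ler1n.
      have : 0 <= ((1 < n.-1)%N + (3 < n.-1)%N)%:R * M by rewrite mulr_ge0//; lra.
      by rewrite /t; lra.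
    by rewrite expr2; apply: ler_pM; lra.
  have l3 : \sum_(0 <= i < n.-2) orient (parabola t i) (parabola t i.+1)
      (parabola t i.+2) <= n.-2%:R * (3 * M) ^+ 2.
    rewrite mulr_natl -[X in _ *+ X](subn0 n.-2) -sumr_const_nat.
    by apply: ler_sum_nat => i /andP[_ lin]; exact: corner_le.
  rewrite /corners (_ : n%:R = n.-2%:R + 1 + 1); last by rewrite !natr1.
  by lra.
have M0 : 0 < M ^+ 2 by rewrite exprn_gt0//; lra.
have M3 : 0 < M ^+ 3 by rewrite exprn_gt0//; lra.
have h : 9 * n%:R * M ^+ 2 <= e * M * M ^+ 2.
  by rewrite ler_wpM2r ?(ltW M0)// [e * M]mulrC -ler_pdivrMr// /M; lra.
have h' : e * (2 * M ^+ 3) <= e * fan n (parabola t) by rewrite ler_wpM2l// ltW.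
have h'' : 0 < e * M ^+ 3 by exact: mulr_gt0.
by lra.
Qed.

Theorem theorem7p4 (R : realType) :
  [/\ forall (m : R) (n : nat) (K : 'I_n -> R * R),
        0 < m < 1 -> (6 <= n)%N -> convex_polygon K ->
        1 - 2 * m * (1 - m) < area (kasner m K) / area K < 1,
      forall (m : R) (n : nat) (e : R),
        0 < m < 1 -> (6 <= n)%N -> 0 < e ->
        exists K : 'I_n -> R * R, convex_polygon K /\
          area (kasner m K) / area K < 1 - 2 * m * (1 - m) + e
    & forall (m : R) (n : nat) (e : R),
        0 < m < 1 -> (6 <= n)%N -> 0 < e ->
        exists K : 'I_n -> R * R, convex_polygon K /\
          1 - e < area (kasner m K) / area K].
Proof.
split.
- move=> m n K m01 n6 /convex_polygon_ccw[P [cP ->]].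
  have n3 : (3 <= n)%N by apply: leq_trans n6.
  have n5 : (5 <= n)%N by apply: leq_trans n6.
  rewrite (kasner_ratio m01 n3 cP).
  have F0 := fan_gt0 n3 cP; have C0 := corners_gt0 n3 cP.
  have CF := corners_lt n5 cP.
  have mm : 0 < m * (1 - m) by case/andP: m01 => ? ?; rewrite mulr_gt0// subr_gt0.
  have r0 : 0 < corners n P / fan n P by exact: divr_gt0.
  have r2 : corners n P / fan n P < 2 by rewrite ltr_pdivrMr.
  by apply/andP; split; nra.
- move=> m n e m01 n6 e0.
  have [P [cP h]] := @polygon_large_corners R n e (leq_trans (isT : (4 <= 6)%N) n6) e0.
  exists (fun i : 'I_n => P i).
  have n3 : (3 <= n)%N by apply: leq_trans n6.
  split; first exact: ccw_convex_polygon.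
  rewrite (kasner_ratio m01 n3 cP).
  have : 2 - e < corners n P / fan n P by rewrite ltr_pdivlMr// fan_gt0.
  case/andP: m01 => m0 m1 r.
  have mm : 0 < m * (1 - m) by rewrite mulr_gt0// subr_gt0.
  (* The slack [e] enters multiplied by [m * (1 - m)], hence stays below [e]. *)
  have mm1 : m * (1 - m) < 1 by nra.
  by nra.
- move=> m n e m01 n6 e0.
  have [P [cP h]] := @polygon_small_corners R n e n6 e0.
  exists (fun i : 'I_n => P i).
  have n3 : (3 <= n)%N by apply: leq_trans n6.
  split; first exact: ccw_convex_polygon.
  rewrite (kasner_ratio m01 n3 cP).
  have r : corners n P / fan n P < e by rewrite ltr_pdivrMr// fan_gt0.
  case/andP: m01 => m0 m1.
  have mm : 0 < m * (1 - m) by rewrite mulr_gt0// subr_gt0.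
  have mm1 : m * (1 - m) < 1 by nra.
  by nra.
Qed.
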